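(* Let $d\ge1$, let $X$ be a separable Fréchet space, let $(\lambda_n)$ be an increasing sequence of positive real numbers satisfying property (FHCSG) and let $(T_a)_{a\in\mathbb R^d}$ be a strongly continuous operator group on $X$ which is uniformly Runge transitive. Then $\bigcap_{a\in S^{d-1}}FHC(T_{\lambda_na})$ is nonempty. In particular, $\bigcap_{a\in\mathbb R^d\setminus\{0\}}FHC(T_a)\ne\varnothing$.
   Context: An operator group $(T_a)_{a\in\mathbb R^d}$ on $X$ is a family of continuous linear operators on $X$ with $T_0=I$ and $T_{a+b}=T_aT_b$; it is strongly continuous if $a\mapsto T_af$ is continuous for each $f\in X$. $\|\cdot\|$ on $\mathbb R^d$ is the Euclidean norm and $S^{d-1}$ is its unit sphere. Uniformly Runge transitive: there is an increasing sequence $(\|\cdot\|_p)_{p\ge 1}$ of seminorms defining the topology of $X$ and positive integers $A_{p,s}$, $C_p$ (for positive integers $p,s$) such that (i) for all $p,s$, all $f\in X$ and all $a\in\mathbb R^d$ with $\|a\|\le s$, $\|T_af\|_p\le A_{p,s}\|f\|_{s+C_p}$; (ii) for all $p,s$ with $s>C_p$, for all $g,h\in X$, all $\varepsilon>0$ and all finite sets $(z_i)\subset\mathbb R^d$ with $\|z_i\|\ge s$ for all $i$ and $\|z_i-z_j\|\ge C_p$ whenever $i\ne j$, there exists $f\in X$ such that $\|f-g\|_{s-C_p}<\varepsilon$ and $\|T_{z_i}f-h\|_p<\varepsilon$ for all $i$. Property (FHCSG): an increasing sequence $(\lambda_n)_{n\ge1}$ has property (FHCSG) if $\lambda_{n+1}-\lambda_n\ge1$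 for any $n\ge1$, and for any $C>0$ there exists $p\in\mathbb N$ such that for any $N\ge1$, $\sum_{n=N+1}^{N+p}\frac1{\lambda_n}\ge\frac{C}{\lambda_N}$. The lower density of $A\subset\mathbb N$ is $\liminf_{N\to+\infty}\frac{\#\{n\le N:\ n\in A\}}{N}$. $FHC(T_{\lambda_na})$ is the set of $x\in X$ such that for every nonempty open $U\subset X$ the set $\{n:\ T_{\lambda_na}x\in U\}$ has positive lower density; $FHC(T_a)$ is the set of $x\in X$ such that for every nonempty open $U\subset X$ the set $\{n:\ T_a^nx\in U\}$ has positive lower density. *)

(* Defs.v *)
From HB Require Import structures.
From mathcomp Require Import all_boot all_order all_algebra.
From mathcomp Require Import all_classical all_reals all_analysis.
From mathcomp Require Import complex.

Set Implicit Arguments.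
Unset Strict Implicit.
Unset Printing Implicit Defensive.

Import Order.TTheory GRing.Theory Num.Theory.
Import numFieldNormedType.Exports.

Local Open Scope classical_set_scope.
Local Open Scope ring_scope.

(* The results hold for real and for complex Frechet spaces alike. *)
Inductive scalar_kind := RealScalars | ComplexScalars.

Definition scalar_field (R : realType) (k : scalar_kind) : numFieldType :=
  match k with
  | RealScalars => R : numFieldType
  | ComplexScalars => complex R : numFieldType
  end.

Section Frechet.
Context {K : numFieldType}.

(* As for MathComp norms, the values lie in K: when K is the complex field,
   0 <= q x forces q x to be a nonnegative real. *)
Definition seminorm (X : lmodType K) (q : X -> K) : Prop :=
  [/\ forall x, 0 <= q x,
      forall (c : K) x, q (c *: x) = `|c| * q x &
      forall x y, q (x + y) <= q x + q y].

(* Sequences of seminorms are indexed by the positive integers;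
   the value at index 0 is irrelevant. Since the sequence is increasing, a
   single seminorm suffices to describe a basic neighbourhood. *)
Definition increasing_seminorms (X : lmodType K) (q : nat -> X -> K) : Prop :=
  (forall p, (0 < p)%N -> seminorm (q p)) /\
  (forall p p' x, (0 < p)%N -> (p <= p')%N -> q p x <= q p' x).

Definition defines_topology (X : tvsType K) (q : nat -> X -> K) : Prop :=
  forall (x : X) (A : set X), nbhs x A <->
    exists p : nat, exists eps : K,
      [/\ (0 < p)%N, 0 < eps & [set y | q p (y - x) < eps] `<=` A].

(* Cauchy for the translation-invariant uniformity of the topological vector
   space. The entourages of a tvsType need not be translation-invariant, so the
   library's cauchy cannot be used. *)
Definition tvs_cauchy_seq (X : tvsType K) (u : nat -> X) : Prop :=
  forall U : set X, nbhs 0 U ->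
    exists N : nat, forall m n, (N <= m)%N -> (N <= n)%N -> U (u m - u n).

Definition frechet_space (X : tvsType K) : Prop :=
  [/\ hausdorff_space X,
      exists q : nat -> X -> K, increasing_seminorms q /\ defines_topology q &
      forall u : nat -> X, tvs_cauchy_seq u -> exists l : X, u @ \oo --> l].

End Frechet.

Definition separable_space (X : topologicalType) : Prop :=
  exists D : set X, countable D /\ dense D.

(* MathComp's norm on row vectors is the sup norm. *)
Definition euclidean_norm (R : realType) (d : nat) (a : 'rV[R]_d) : R :=
  Num.sqrt (\sum_(i < d) a ord0 i ^+ 2).

Section OperatorGroup.
Context {R : realType} {K : numFieldType} {d : nat} {X : tvsType K}.
Implicit Type T : 'rV[R]_d -> {linear X -> X}.

Definition operator_group T : Prop :=
  [/\ forall a, continuous (T a),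
      forall f, T 0 f = f &
      forall a b f, T (a + b) f = T a (T b f)].

Definition strongly_continuous T : Prop :=
  forall f : X, continuous (fun a => T a f).

Definition uniformly_runge_transitive T : Prop :=
  exists (q : nat -> X -> K) (A : nat -> nat -> nat) (C : nat -> nat),
  [/\ increasing_seminorms q /\ defines_topology q,
      (forall p s, (0 < p)%N -> (0 < s)%N -> (0 < A p s)%N) /\
      (forall p, (0 < p)%N -> (0 < C p)%N),
      forall (p s : nat) (f : X) (a : 'rV[R]_d), (0 < p)%N -> (0 < s)%N ->
        euclidean_norm a <= s%:R -> q p (T a f) <= (A p s)%:R * q (s + C p)%N f &
      forall (p s : nat) (g h : X) (eps : K) (m : nat) (z : 'I_m -> 'rV[R]_d),
        (0 < p)%N -> (C p < s)%N -> 0 < eps ->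
        (forall i, s%:R <= euclidean_norm (z i)) ->
        (forall i j, i != j -> (C p)%:R <= euclidean_norm (z i - z j)) ->
        exists f : X, q (s - C p)%N (f - g) < eps /\
          forall i, q p (T (z i) f - h) < eps].

End OperatorGroup.

Section FrequentHypercyclicity.
Context (R : realType).

(* The term of index 0 of lambda is irrelevant. *)
Definition property_FHCSG (lambda : nat -> R) : Prop :=
  (forall n, (1 <= n)%N -> 1 <= lambda n.+1 - lambda n) /\
  (forall C : R, 0 < C -> exists p : nat, forall N, (1 <= N)%N ->
     C / lambda N <= \sum_(N.+1 <= n < (N + p).+1) (lambda n)^-1).

Definition lower_density (A : set nat) : \bar R :=
  limn_einf (fun N : nat =>
    ((\sum_(1 <= n < N.+1) (n \in A : nat))%N%:R / N%:R)%:E).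

Definition FHC (X : topologicalType) (S : nat -> X -> X) : set X :=
  [set x | forall U : set X, open U -> U !=set0 ->
             (0 < lower_density [set n | U (S n x)])%E].

End FrequentHypercyclicity.

(* Main.v *)
Require Import Defs.
From HB Require Import structures.
From mathcomp Require Import all_boot all_order all_algebra.
From mathcomp Require Import all_classical all_reals all_analysis.
From mathcomp Require Import complex.
From mathcomp Require Import zify ring lra.

(* Property (ii) lets one vector f satisfy T_z f ~ h simultaneously for all z in
   a separated finite set far from the origin. Doing this successively in
   annuli that move away from the origin, each devoted to one of countably many
   targets and each kind of annulus recurring with positive frequency, one is
   left with a covering problem: find a separated set Z in an annulus, whose
   width does not depend on its inner radius, such that for every parameter a
   the sequence (lambda_n a), resp. (n a), comes close to Z inside the annulus.

   For (lambda_n a) with a in the sphere, one covers R^d by balls of radius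
   e / lambda_n around c / lambda_n-separated centers, with n in a window of
   bounded length, by induction on the dimension; (FHCSG) is what makes this
   possible in dimension one.

   For (n a) with a arbitrary, T_a^n = T_{n a} and one treats all a with
   1/B <= |a| <= B directly: Z is a union of shifted pieces of a lattice in
   successive shells. For random shifts, the probability that a given arithmetic
   progression misses Z decays exponentially with the number of shells, while
   the number of progressions to be distinguished grows polynomially. *)

Set Implicit Arguments.
Unset Strict Implicit.
Unset Printing Implicit Defensive.

Import Order.TTheory GRing.Theory Num.Theory.
Import numFieldNormedType.Exports.

Local Open Scope classical_set_scope.
Local Open Scope ring_scope.

(** * Simultaneous approximation in successive annuli *)

Lemma seminorm0 (K : numFieldType) (X : lmodType K) (q : X -> K) :
  seminorm q -> q 0 = 0.
Proof. by case=> _ qZ _; rewrite -(scale0r 0) qZ normr0 mul0r. Qed.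

Lemma seminormN (K : numFieldType) (X : lmodType K) (q : X -> K) x :
  seminorm q -> q (- x) = q x.
Proof. by case=> _ qZ _; rewrite -scaleN1r qZ normrN1 mul1r. Qed.

Lemma seminorm_ball_nbhs (K : numFieldType) (X : tvsType K) (q : nat -> X -> K)
    p (x : X) (e : K) :
  defines_topology q -> (0 < p)%N -> 0 < e -> nbhs x [set y | q p (y - x) < e].
Proof. by move=> qtop p0 e0; apply/qtop; exists p, e; split. Qed.

Lemma leq_prod_ord (w : nat -> nat) (i j : nat) :
  (forall k, 0 < w k)%N -> (i <= j)%N -> (w i <= \prod_(k < j.+1) w k)%N.
Proof.
move=> w0 ij; have ij' : (i < j.+1)%N by [].
rewrite (bigD1 (Ordinal ij')) //= leq_pmulr // prodn_gt0 //.
Qed.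

(* Stage [j] corrects the current vector on the annulus [s j <= |z| <= u j]; by
   the separation of the annuli the correction can be made so small in the
   seminorms seen by the earlier stages that these survive. *)
Lemma simultaneous_approximation (R : realType) (K : numFieldType) (d : nat)
    (X : tvsType K) (T : 'rV[R]_d -> {linear X -> X}) (q : nat -> X -> K)
    (A : nat -> nat -> nat) (C : nat -> nat) (P : nat -> nat) (h : nat -> X)
    (M s u : nat -> nat) (Z : nat -> set 'rV[R]_d) :
  (forall e : K, 0 < e -> exists n : nat, n.+1%:R^-1 < e) ->
  (forall v : nat -> X, tvs_cauchy_seq v -> exists l : X, v @ \oo --> l) ->
  (forall a, continuous (T a)) ->
  increasing_seminorms q -> defines_topology q ->
  (forall p s, (0 < p)%N -> (0 < s)%N -> (0 < A p s)%N) ->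
  (forall p, (0 < p)%N -> (0 < C p)%N) ->
  (forall (p s : nat) (f : X) (a : 'rV[R]_d), (0 < p)%N -> (0 < s)%N ->
     euclidean_norm a <= s%:R -> q p (T a f) <= (A p s)%:R * q (s + C p)%N f) ->
  (forall (p s : nat) (g h : X) (eps : K) (m : nat) (z : 'I_m -> 'rV[R]_d),
     (0 < p)%N -> (C p < s)%N -> 0 < eps ->
     (forall i, s%:R <= euclidean_norm (z i)) ->
     (forall i j, i != j -> (C p)%:R <= euclidean_norm (z i - z j)) ->
     exists f : X, q (s - C p)%N (f - g) < eps /\
       forall i, q p (T (z i) f - h) < eps) ->
  (forall j, 0 < P j)%N -> (forall j, 0 < M j)%N ->
  (forall j, C (P j) < s j)%N -> (forall j, s j <= u j)%N ->
  (forall i j, (i < j)%N -> (u i + C (P i) + C (P j) <= s j)%N) ->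
  (forall j, finite_set (Z j)) ->
  (forall j z, Z j z -> (s j)%:R <= euclidean_norm z <= (u j)%:R) ->
  (forall j z z', Z j z -> Z j z' -> z != z' ->
     (C (P j))%:R <= euclidean_norm (z - z')) ->
  exists f : X, forall j z, Z j z -> q (P j) (T z f - h j) <= 2 / (M j)%:R.
Proof.
move=> arch complete Tcont [qsemi qincr] qtop A0 C0 bound runge P0 M0 Cs su sep.
move=> Zfin Znorm Zsep.
have u0 j : (0 < u j)%N by apply: leq_trans (su j); apply: leq_ltn_trans (Cs j).
(* The product of the [w i] dominates each factor, so the one tolerance [eta j] protects every stage
   [i <= j]; the power of 2 makes the corrections summable. *)
pose w j := (M j * A (P j) (u j))%N.
have w0 j : (0 < w j)%N by rewrite muln_gt0 M0 A0.
pose B j := (2 ^ j.+1 * \prod_(i < j.+1) w i)%N.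
have B0 j : (0 < B j)%N by rewrite muln_gt0 expn_gt0 /= prodn_gt0.
pose eta j : K := (B j)%:R^-1.
have eta0 j : 0 < eta j by rewrite invr_gt0 ltr0n.
have /choice [step stepP] : forall jg : nat * X, exists f : X,
    q (s jg.1 - C (P jg.1))%N (f - jg.2) < eta jg.1 /\
    forall z, Z jg.1 z -> q (P jg.1) (T z f - h jg.1) < eta jg.1.
  (* [undup] makes distinct positions carry distinct points, to which the separation of [Z j]
     applies. *)
  move=> [j g] /=; have /finite_seqP [l Zl] := Zfin j.
  have zP i : Z j (tnth (in_tuple (undup l)) i).
    by rewrite Zl /= -mem_undup mem_tnth.
  have zinj : injective (tnth (in_tuple (undup l))).
    by apply/tuple_uniqP; exact: undup_uniq.
  have [||f [fg fT]] := runge (P j) (s j) g (h j) (eta j) _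
    (tnth (in_tuple (undup l))) (P0 j) (Cs j) (eta0 j).
  - by move=> i; have /andP [] := Znorm _ _ (zP i).
  - move=> i i' ii'; apply: Zsep => //.
    by apply: contra_neq ii' => /zinj.
  exists f; split=> // z; rewrite Zl /= -mem_undup => zl.
  by have /tnthP [i ->] : z \in in_tuple (undup l) by [].
pose F := fix F n := if n is m.+1 then step (m, F m) else 0 : X.
have FS n : q (s n - C (P n))%N (F n.+1 - F n) < eta n.
  by have [] := stepP (n, F n).
have FT n z : Z n z -> q (P n) (T z (F n.+1) - h n) < eta n.
  by have [_] := stepP (n, F n); apply.
(* Hence, for fixed [p], the corrections of all stages [j >= p] are small in [q p], which makes [F]
   Cauchy. *)
have sC j : (j < s j - C (P j))%N.
  elim: j => [|j IH]; first by rewrite subn_gt0.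
  have := sep j j.+1 (ltnSn j); have := su j; have := Cs j; have := Cs j.+1.
  have := C0 _ (P0 j).
  by lia.
(* A correction of size [eta j] moves [T z F], for [z] in stage [i <= j], by at
   most [2^-(j+1) / M i]. *)
have eta_le i j : (i <= j)%N ->
    (A (P i) (u i))%:R * eta j <= (2 ^+ j.+1)^-1 / (M i)%:R.
  move=> ij; have wB : (2 ^ j.+1 * w i <= B j)%N.
    by rewrite leq_mul2l leq_prod_ord ?orbT.
  have -> : (2 ^+ j.+1)^-1 / (M i)%:R
      = (A (P i) (u i))%:R * ((2 ^ j.+1 * w i)%N%:R)^-1 :> K.
    rewrite /w !natrM natrX; field.
    by rewrite !pnatr_eq0 -!lt0n M0 A0 ?expf_neq0 ?pnatr_eq0.
  rewrite ler_wpM2l ?ler0n // lef_pV2 ?posrE ?ltr0n ?ler_nat //.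
  by rewrite muln_gt0 expn_gt0 w0.
have eta_le2 j : eta j <= (2 ^+ j.+1)^-1.
  have := eta_le j j (leqnn j); rewrite ler_pdivlMr ?ltr0n //.
  apply: le_trans; rewrite mulrAC -natrM ler_peMl ?(ltW (eta0 _)) //.
  by rewrite ler1n muln_gt0 A0 //= M0.
have halves n : (2 ^+ n)^-1 = (2 ^+ n.+1)^-1 + (2 ^+ n.+1)^-1 :> K.
  by rewrite exprS; field; rewrite expf_neq0 ?pnatr_eq0.
have Fcauchy p m n : (0 < p)%N -> (p <= m)%N -> (m <= n)%N ->
    q p (F n - F m) <= (2 ^+ m)^-1 - (2 ^+ n)^-1.
  move=> p0 pm; elim: n => [|n IH].
    by rewrite leqn0 => /eqP ->; rewrite !subrr seminorm0 //; exact: qsemi.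
  rewrite leq_eqVlt => /orP [/eqP ->|mn].
    by rewrite !subrr seminorm0 //; exact: qsemi.
  have [_ _ qD] := qsemi p p0.
  have -> : F n.+1 - F m = (F n.+1 - F n) + (F n - F m) by rewrite addrA subrK.
  apply: le_trans (qD _ _) _.
  have -> : (2 ^+ m)^-1 - (2 ^+ n.+1)^-1 =
      (2 ^+ n.+1)^-1 + ((2 ^+ m)^-1 - (2 ^+ n)^-1) :> K.
    by rewrite (halves n); ring.
  apply: lerD; last exact: IH.
  apply: le_trans (eta_le2 n); apply: le_trans (ltW (FS n)).
  by apply: qincr => //; have := sC n; lia.
have [f Ff] : exists f : X, F @ \oo --> f.
  apply: complete => U /qtop [p [e [p0 e0 eU]]].
  have [n0 n0e] := arch e e0.
  exists (maxn p n0) => m n.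
  rewrite !geq_max => /andP [pm nm] /andP [pn nn].
  apply: eU => /=; rewrite subr0; apply: le_lt_trans n0e.
  have aux k l : (p <= k)%N -> (n0 <= k)%N -> (k <= l)%N ->
      q p (F l - F k) <= n0.+1%:R^-1.
    move=> pk nk kl; apply: le_trans (Fcauchy _ _ _ p0 pk kl) _.
    apply: (@le_trans _ _ (2 ^+ k)^-1).
      by rewrite gerBl invr_ge0 exprn_ge0.
    rewrite lef_pV2 ?posrE ?ltr0n ?exprn_gt0 // -natrX ler_nat.
    by apply: leq_ltn_trans nk (ltn_expl _ _).
  have [mn|/ltnW mn] := leqP m n; last exact: aux.
  by rewrite -(seminormN _ (qsemi p p0)) opprB; exact: aux.
exists f => j z Zz.
have [q0 qZ qD] := qsemi _ (P0 j).
(* Partial sums of a geometric series; passing to the limit [f] costs the second [1 / M j]. *)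
have FTn n : (j < n)%N ->
    q (P j) (T z (F n) - h j) <= (1 - (2 ^+ n)^-1) / (M j)%:R.
  elim: n => // n IH; rewrite ltnS leq_eqVlt => /orP [/eqP <-|jn].
    apply: le_trans (ltW (FT _ _ Zz)) _.
    have -> : 1 - (2 ^+ j.+1)^-1 = (2 ^+ j.+1)^-1 + (1 - (2 ^+ j)^-1) :> K.
      by rewrite (halves j); ring.
    rewrite mulrDl -[leLHS]addr0; apply: lerD.
      apply: le_trans (eta_le j j (leqnn j)).
      by rewrite ler_peMl ?(ltW (eta0 _)) // ler1n A0.
    rewrite divr_ge0 ?ler0n // subr_ge0 invf_le1 ?exprn_gt0 ?ltr0n //.
    by rewrite -natrX ler1n expn_gt0.
  have -> : T z (F n.+1) - h j = T z (F n.+1 - F n) + (T z (F n) - h j).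
    by rewrite linearB /= addrA subrK.
  apply: le_trans (qD _ _) _.
  have -> : 1 - (2 ^+ n.+1)^-1 = (2 ^+ n.+1)^-1 + (1 - (2 ^+ n)^-1) :> K.
    by rewrite (halves n); ring.
  rewrite mulrDl; apply: lerD; last exact: IH.
  have /andP [_ zu] := Znorm _ _ Zz.
  apply: le_trans (bound (P j) (u j) _ z (P0 j) (u0 j) zu) _.
  apply: le_trans (eta_le j n (ltnW jn)).
  apply: ler_wpM2l; first exact: ler0n.
  apply: le_trans (ltW (FS n)); apply: qincr.
    by rewrite addn_gt0 u0.
  by have := sep j n jn; lia.
have Mj0 : 0 < (M j)%:R^-1 :> K by rewrite invr_gt0 ltr0n.
have /(_ _ (seminorm_ball_nbhs (T z f) qtop (P0 j) Mj0)) :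
    (T z \o F) @ \oo --> T z f.
  by apply: cvg_comp Ff _; exact: Tcont.
case=> N _ /(_ (maxn N j.+1)) /=.
rewrite leq_maxl => /(_ isT); set n := maxn N j.+1 => Nn.
have jn : (j < n)%N by exact: leq_maxr.
have -> : T z f - h j = - (T z (F n) - T z f) + (T z (F n) - h j).
  by rewrite opprB addrA subrK.
apply: le_trans (qD _ _) _; rewrite seminormN; last exact: qsemi.
rewrite -[2]/(1 + 1) mulrDl mul1r; apply: lerD; first exact: ltW.
apply: le_trans (FTn _ jn) _.
by rewrite ler_pdivrMr ?ltr0n // mulVf ?pnatr_eq0 -?lt0n // gerBl invr_ge0 exprn_ge0.
Qed.

(** * Recurring types of stages and lower density *)

(* The [j]-th interval, of length at least [L (typ j)], starts at [pos j]. Type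
   [k] recurs along an arithmetic progression, but so rarely compared to [L k]
   that positions still grow linearly. *)
Lemma schedule (L : nat -> nat) : exists (pos typ : nat -> nat) (B : nat),
  [/\ forall j, (pos j + L (typ j) <= pos j.+1)%N,
      forall j, (pos j <= B * j)%N &
      forall k, exists c c', (0 < c)%N /\ forall i, typ (c * i + c')%N = k].
Proof.
(* Type [k] will occur at most once in [b k] stages; the factor [2^k (L k + 1)] keeps its average
   contribution to the length below [2^-k] for [k >= 1]. *)
pose b := fix b k := if k is l.+1 then (b l * (2 ^ k * (L k).+1))%N else 1%N.
have b0 k : (0 < b k)%N.
  by elim: k => //= k IH; rewrite muln_gt0 IH muln_gt0 expn_gt0.
have b_gt k : (k < b k)%N.
  elim: k => //= k IH.
  apply: leq_trans (_ : (b k * 2 <= _)%N); first by lia.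
  by rewrite leq_mul2l expnS -mulnA leq_pmulr ?orbT // muln_gt0 expn_gt0.
have b_big k : (2 ^ k.+1 * L k.+1 <= b k.+1)%N.
  rewrite /=; apply: leq_trans (_ : (2 ^ k.+1 * (L k.+1).+1 <= _)%N).
    by rewrite leq_mul2l leqnSn orbT.
  by rewrite leq_pmull.
have bS k : (b k < b k.+1)%N.
  rewrite /= -[X in (X < _)%N]muln1 ltn_mul2l b0 /= expnS -mulnA.
  have := expn_gt0 2 k; nia.
have b_dvd k l : (k <= l)%N -> (b k %| b l)%N.
  elim: l => [|l IH]; first by rewrite leqn0 => /eqP ->.
  rewrite leq_eqVlt => /orP [/eqP -> //|/IH kl].
  by rewrite /= dvdn_mulr.
have b00 : b 0%N = 1%N by [].
clearbody b.
(* The shift to [j.+1] avoids 0, which every [b k] divides; since [k < b k], the bound [j.+2] loses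
   no divisor. *)
pose typ j := (\max_(k < j.+2 | (b k %| j.+1)%N) k)%N.
have typ_dvd j : (b (typ j) %| j.+1)%N.
  have := @bigop.bigmax_eq_arg 'I_j.+2 ord0 (fun k => b k %| j.+1)%N (@nat_of_ord _).
  rewrite /typ => -> /=; last by rewrite b00; exact: dvd1n.
  by case: arg_maxnP => //=; rewrite b00 // => _; exact: dvd1n.
have typ_lt j : (typ j < j.+2)%N.
  by rewrite ltnS; apply/bigmax_leqP => i _; rewrite -ltnS.
pose pos J := (\sum_(j < J) L (typ j))%N.
exists pos, typ, (L 0%N).+1; split.
- by move=> j; rewrite /pos big_ord_recr.
- move=> J.
  have le1 : (pos J <= \sum_(k < J.+1) L k * (J %/ b k))%N.
    rewrite /pos.
    apply: leq_trans (_ : (\sum_(j < J) \sum_(k < J.+1) (b k %| j.+1) * L k <= _)%N).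
      apply: leq_sum => j _.
      have tj : (typ j < J.+1)%N.
        by apply: leq_trans (typ_lt j) _; rewrite ltnS.
      by rewrite (bigD1 (Ordinal tj)) //= typ_dvd mul1n leq_addr.
    rewrite exchange_big /=; apply: leq_sum => k _.
    rewrite divn_count_dvd big_distrr /= big_add1 /= big_mkord.
    by apply: eq_leq; apply: eq_bigr => j _; rewrite mulnC.
  apply: leq_trans le1 _; rewrite big_ord_recl /= b00 divn1 mulSn addnC leq_add2r.
  under eq_bigr do rewrite /bump leq0n add1n.
  (* That is, the sum is at most [J (1 - 2^-n)], written without subtraction or fractions. *)
  have /(_ J) : forall n,
      (2 ^ n * (\sum_(k < n) L k.+1 * (J %/ b k.+1)) + J <= 2 ^ n * J)%N.
    elim=> [|n IH]; first by rewrite big_ord0 muln0 mul1n.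
    have : (2 ^ n.+1 * (L n.+1 * (J %/ b n.+1)) <= J)%N.
      rewrite mulnA; apply: leq_trans (leq_trunc_div J (b n.+1)).
      by rewrite mulnC leq_mul2l b_big orbT.
    move: IH; rewrite big_ord_recr /= expnS.
    by move: (2 ^ n)%N (\sum_(k < n) _)%N (L n.+1 * _)%N => y S x; nia.
  move=> H; rewrite -(@leq_pmul2l (2 ^ J)) ?expn_gt0 //.
  by apply: leq_trans H; exact: leq_addr.
(* Here [j + 1] is congruent to [b k] modulo [b k.+1], so [b k] divides it, but [b k.+1] and all
   later terms do not. *)
- move=> k; exists (b k.+1), (b k).-1; split=> // i.
  have e : ((b k.+1 * i + (b k).-1).+1 = b k.+1 * i + b k)%N.
    by rewrite -addnS prednK.
  apply/eqP; rewrite eqn_leq; apply/andP; split.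
    rewrite leqNgt; apply/negP => /b_dvd kt.
    have := dvdn_trans kt (typ_dvd _); rewrite e dvdn_addr ?dvdn_mulr //.
    by move=> /(dvdn_leq (b0 k)); rewrite leqNgt bS.
  have kj : (k < (b k.+1 * i + (b k).-1).+2)%N.
    by rewrite e; have := b_gt k; lia.
  rewrite /typ (bigD1 (Ordinal kj)) /= ?leq_maxl //.
  by rewrite e dvdn_add // dvdn_mulr // b_dvd.
Qed.

(** The first [n %/ K] values of [f] are distinct and at most [n]; for [n >= K] the rounding loses
    at most a factor 2, whence the bound [1 / (2 K)]. *)
Lemma lower_density_gt0 (R : realType) (A : set nat) (f : nat -> nat) (K : nat) :
  (0 < K)%N -> injective f ->
  (forall i, (0 < f i <= K * i.+1)%N) -> (forall i, A (f i)) ->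
  (0 < lower_density R A)%E.
Proof.
move=> K0 finj fK fA; rewrite /lower_density limn_einf_lim.
apply: (@lt_le_trans _ _ (((2 * K)%N%:R : R)^-1)%:E).
  by rewrite lte_fin invr_gt0 ltr0n muln_gt0.
apply: lime_ge; first exact: is_cvg_einfs.
exists K => //= N KN; apply: le_ereal_inf_tmp => _ [n /= Nn <-].
have {}KN : (K <= n)%N := leq_trans KN Nn.
have n0 : (0 < n)%N := leq_trans K0 KN.
rewrite lee_fin ler_pdivlMr ?ltr0n // mulrC ler_pdivrMr ?ltr0n ?muln_gt0 //.
rewrite -natrM ler_nat.
have cnt : (n %/ K <= \sum_(1 <= m < n.+1) (m \in A))%N.
  have -> : (\sum_(1 <= m < n.+1) (m \in A) =
      size [seq m <- index_iota 1 n.+1 | m \in A])%N.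
    rewrite size_filter -sum1_count [RHS]big_mkcond /=.
    by apply: eq_bigr => m _; case: (m \in A).
  rewrite -[leqLHS](size_iota 0) -(size_map f); apply: uniq_leq_size.
    by rewrite map_inj_uniq ?iota_uniq.
  move=> m /mapP [j]; rewrite mem_iota => /= jk ->.
  rewrite mem_filter mem_set //= mem_index_iota.
  have /andP [-> fj] := fK j; rewrite ltnS /=.
  apply: leq_trans fj _; rewrite mulnC.
  by apply: leq_trans (leq_trunc_div n K); rewrite leq_mul2r jk orbT.
have := divn_eq n K; have := ltn_pmod n K0.
move: cnt KN; set x := (\sum_(1 <= m < n.+1) _)%N.
move: (n %/ K)%N (n %% K)%N => y r yx Kn rK ny.
have := leq_mul yx (leqnn (2 * K)); case: y ny {yx} => [|y]; lia.
Qed.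

Lemma scalar_field_archimedean (R : realType) (k : scalar_kind)
    (e : scalar_field R k) : 0 < e -> exists n : nat, n.+1%:R^-1 < e.
Proof.
have real (x : R) : 0 < x -> exists n : nat, n.+1%:R^-1 < x.
  move=> x0; exists (Num.truncn x^-1).
  by rewrite invf_plt ?posrE ?ltr0n // truncnS_gt.
case: k e => //= -[x y]; rewrite ltcE /= => /andP [/eqP -> x0].
have [n nx] := real x x0.
exists n; rewrite -(rmorph_nat (real_complex R)) -fmorphV /=.
by rewrite ltcE /= eqxx.
Qed.

(** * Euclidean norm *)

Section EuclideanNorm.
Context {R : realType} {d : nat}.
Implicit Types (a b : 'rV[R]_d) (c : R).

Lemma euclidean_norm_ge0 a : 0 <= euclidean_norm a.
Proof. exact: sqrtr_ge0. Qed.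

Lemma euclidean_norm_sqr a : euclidean_norm a ^+ 2 = \sum_(i < d) a ord0 i ^+ 2.
Proof. by rewrite sqr_sqrtr // sumr_ge0 // => i _; exact: sqr_ge0. Qed.

Lemma euclidean_norm0 : euclidean_norm (0 : 'rV[R]_d) = 0.
Proof.
apply/eqP; rewrite -sqrf_eq0 euclidean_norm_sqr; apply/eqP.
by rewrite big1 // => i _; rewrite mxE expr0n.
Qed.

Lemma euclidean_normZ c a : euclidean_norm (c *: a) = `|c| * euclidean_norm a.
Proof.
rewrite /euclidean_norm -sqrtr_sqr -sqrtrM ?sqr_ge0 // mulr_sumr.
by congr Num.sqrt; apply: eq_bigr => i _; rewrite mxE exprMn.
Qed.

Lemma euclidean_normN a : euclidean_norm (- a) = euclidean_norm a.
Proof. by rewrite -scaleN1r euclidean_normZ normrN1 mul1r. Qed.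

Lemma euclidean_norm_coord a i : `|a ord0 i| <= euclidean_norm a.
Proof.
rewrite -sqrtr_sqr ler_wsqrtr // (bigD1 i) //= lerDl sumr_ge0 // => j _.
exact: sqr_ge0.
Qed.

Lemma euclidean_norm_eq0 a : (euclidean_norm a == 0) = (a == 0).
Proof.
apply/eqP/eqP => [a0|->]; last exact: euclidean_norm0.
apply/rowP => i; apply/eqP; rewrite mxE -normr_le0 -a0.
exact: euclidean_norm_coord.
Qed.

Lemma dot_le_euclidean_norm a b :
  \sum_(i < d) a ord0 i * b ord0 i <= euclidean_norm a * euclidean_norm b.
Proof.
set p : R := \sum_(_ < _) _.
have [b0|b0] := eqVneq (euclidean_norm b) 0.
  rewrite b0 mulr0 /p big1 // => i _; move/eqP: b0; rewrite euclidean_norm_eq0.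
  by move=> /eqP ->; rewrite mxE mulr0.
have nb : 0 < euclidean_norm b by rewrite lt_neqAle eq_sym b0 euclidean_norm_ge0.
apply: le_trans (ler_norm p) _.
rewrite -ler_sqr ?nnegrE ?mulr_ge0 ?euclidean_norm_ge0 //.
rewrite real_normK ?num_real // exprMn !euclidean_norm_sqr.
(* Nonnegativity of [|B a - p b|^2], where [B = |b|^2]. *)
set B : R := \sum_(i < d) b ord0 i ^+ 2; set S : R := \sum_(i < d) a ord0 i ^+ 2.
have B0 : 0 < B by rewrite /B -euclidean_norm_sqr exprn_gt0.
have : 0 <= \sum_(i < d) (B * a ord0 i - p * b ord0 i) ^+ 2.
  by apply: sumr_ge0 => i _; exact: sqr_ge0.
have -> : \sum_(i < d) (B * a ord0 i - p * b ord0 i) ^+ 2 = B * (S * B - p ^+ 2) :> R.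
  rewrite (eq_bigr (fun i => B ^+ 2 * a ord0 i ^+ 2 +
    (- (B * p * 2) * (a ord0 i * b ord0 i) + p ^+ 2 * b ord0 i ^+ 2))); last first.
    by move=> i _; ring.
  by rewrite !big_split /= -!mulr_sumr -/B -/S -/p; ring.
by rewrite pmulr_rge0 // subr_ge0.
Qed.

Lemma euclidean_normD a b :
  euclidean_norm (a + b) <= euclidean_norm a + euclidean_norm b.
Proof.
rewrite -ler_sqr ?nnegrE ?addr_ge0 ?euclidean_norm_ge0 //.
rewrite sqrrD !euclidean_norm_sqr.
have -> : \sum_(i < d) (a + b) ord0 i ^+ 2 =
   \sum_(i < d) a ord0 i ^+ 2 + (\sum_(i < d) a ord0 i * b ord0 i) *+ 2
   + \sum_(i < d) b ord0 i ^+ 2.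
  rewrite -sumrMnl -!big_split /=; apply: eq_bigr => i _.
  by rewrite mxE sqrrD.
by rewrite lerD2r lerD2l ler_pMn2r // dot_le_euclidean_norm.
Qed.

Lemma euclidean_norm_dist a b :
  `|euclidean_norm a - euclidean_norm b| <= euclidean_norm (a - b).
Proof.
have h (x y : 'rV[R]_d) : euclidean_norm x - euclidean_norm y <= euclidean_norm (x - y).
  by rewrite lerBlDr; have := euclidean_normD (x - y) y; rewrite subrK.
have ba : euclidean_norm (b - a) = euclidean_norm (a - b).
  by rewrite -opprB euclidean_normN.
by have := h b a; have := h a b; rewrite ba ler_norml; lra.
Qed.

Lemma euclidean_norm_le_coord a c :
  (forall i, `|a ord0 i| <= c) -> 0 <= c -> euclidean_norm a <= d%:R * c.
Proof.
move=> ac c0; rewrite -[leRHS]ger0_norm ?mulr_ge0 // -sqrtr_sqr ler_wsqrtr //.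
apply: (@le_trans _ _ (\sum_(i < d) c ^+ 2)).
  apply: ler_sum => i _; rewrite -real_normK ?num_real //.
  by rewrite ler_sqr ?nnegrE // (le_trans _ (ac i)).
rewrite sumr_const card_ord exprMn -[leLHS]mulr_natl ler_wpM2r ?sqr_ge0 //.
by rewrite -natrX ler_nat; case: (d) => // n; rewrite leq_pmulr.
Qed.

(** In a grid of cubes of side [c / (d+1)], two points of one cube are less than [c] apart, so each
    of the finitely many cubes holds at most one point of [Z]. *)
Lemma separated_bounded_finite (Z : set 'rV[R]_d) c (B : R) : 0 < c ->
  (forall z, Z z -> euclidean_norm z <= B) ->
  (forall z z', Z z -> Z z' -> z != z' -> c <= euclidean_norm (z - z')) ->
  finite_set Z.
Proof.
move=> c0 ZB Zsep.
pose e := c / d.+1%:R; have e0 : 0 < e by rewrite divr_gt0.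
pose N := Num.truncn (2 * `|B| / e).
pose code (z : 'rV[R]_d) : {ffun 'I_d -> 'I_N.+1} :=
  [ffun i => inord (Num.truncn ((z ord0 i + `|B|) / e))].
pose g (t : {ffun 'I_d -> 'I_N.+1}) := xget 0 [set z | Z z /\ code z = t].
apply: (@sub_finite_set _ _ (g @` setT)); last exact: finite_image.
move=> z Zz; exists (code z) => //; rewrite /g.
case: xgetP => [z' _ [Zz' zz'] | /(_ z) []]; last by split.
apply/eqP/negP => /negP nz; have := Zsep _ _ Zz' Zz nz.
have zB x i : Z x -> `|x ord0 i| <= `|B|.
  move=> /ZB xB; apply: le_trans (euclidean_norm_coord _ _) _.
  by apply: le_trans xB _; exact: ler_norm.
have cell x i : Z x -> (code x i)%:R <= (x ord0 i + `|B|) / e < (code x i)%:R + 1.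
  move=> Zx; have := zB x i Zx; rewrite ler_norml => /andP [xB1 xB2].
  have x0 : 0 <= (x ord0 i + `|B|) / e by rewrite divr_ge0 ?(ltW e0) //; lra.
  rewrite ffunE inordK ?natr1 ?truncn_itv // ltnS le_truncn // ler_pM2r ?invr_gt0 //.
  lra.
apply/negP; rewrite -ltNge.
apply: (@le_lt_trans _ _ (d%:R * e)).
  apply: euclidean_norm_le_coord; last exact: ltW.
  move=> i; have := cell _ i Zz; have := cell _ i Zz'; rewrite zz'.
  rewrite !mxE; set u := (z' ord0 i + _) / e; set v := (z ord0 i + _) / e.
  move=> /andP [h1 h2] /andP [h3 h4].
  have -> : z' ord0 i - z ord0 i = (u - v) * e by rewrite /u /v; field; lra.
  rewrite normrM (gtr0_norm e0) ler_piMl ?(ltW e0) // ler_norml; lra.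
by rewrite /e mulrCA gtr_pMr // ltr_pdivrMr // mul1r ltr_nat.
Qed.

End EuclideanNorm.

(** * Covering the sphere at the scales given by lambda *)

(** Intervals of lengths [2 * w j] laid end to end from 0 fill the period [[0, s)], to which [y] is
    reduced modulo [s]. *)
Lemma line_cover (R : realType) (w : nat -> R) (s : R) (J : nat) : 0 < s ->
  s <= \sum_(j < J) 2 * w j ->
  forall y : R, exists j (z : int), (j < J)%N /\
    `|y - (\sum_(i < j) 2 * w i + w j + s * z%:~R)| <= w j.
Proof.
move=> s0 sw y; set z := Num.floor (y / s).
pose r := y - s * z%:~R.
have [r0 rs] : 0 <= r /\ r < s.
  have /andP [] := floor_itv (y / s); rewrite -/z intrD.
  rewrite ler_pdivlMr // ltr_pdivrMr // mulrDl mul1r /r mulrC; lra.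
pose t n := \sum_(i < n) 2 * w i.
have {rs sw} : r < t J by apply: lt_le_trans sw.
elim: J => [|J IH]; first by rewrite /t big_ord0 ltNge r0.
have [/IH [j [z' [jJ h]]] _|tr rt] := ltP r (t J).
  by exists j, z'; split=> //; exact: ltnW.
exists J, z; split=> //; rewrite -/(t J).
move: rt; rewrite /t big_ord_recr /= -/(t J) => rt.
have -> : y = r + s * z%:~R by rewrite subrK.
by rewrite ler_norml; apply/andP; split; lra.
Qed.

(** A block of [p] terms is at most [p] times the term just before it. This transfers the lower
    bound of (FHCSG) to sums sampled once per window. *)
Lemma sum_decreasing_le_step (R : realType) (f : nat -> R) (p : nat) :
  (forall m n, (1 <= m)%N -> (m <= n)%N -> f n <= f m) ->
  forall N K, (1 <= N)%N -> \sum_(N.+1 <= n < (N + K * p).+1) f n <=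
    p%:R * \sum_(j < K) f (N + j * p)%N.
Proof.
move=> fdecr N K N0; elim: K => [|K IH].
  by rewrite mul0n addn0 big_geq // big_ord0 mulr0.
rewrite big_ord_recr /= mulrDr (@big_cat_nat _ _ _ (N + K * p).+1) /=; first last.
- by rewrite ltnS leq_add2l leq_mul2r leqnSn orbT.
- by rewrite ltnS leq_addr.
apply: lerD IH _.
apply: (@le_trans _ _ (\sum_((N + K * p).+1 <= n < (N + K.+1 * p).+1)
                         f (N + K * p)%N)).
  apply: ler_sum_nat => n /andP [Kn _]; apply: fdecr; last exact: ltnW.
  by rewrite addn_gt0 N0.
by rewrite sumr_const_nat subSS mulSn addnCA addnK mulr_natl.
Qed.

(* Points of [R^m] are sequences of which only the first [m] coordinates matter.
   From [m] to [m+1]: cover [R^m] repeatedly, on consecutive windows of [p]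
   indices; the [j]-th window serves the slabs of half width [w j] around
   [t j + s Z] in the last coordinate, where [s = c / lambda N]. Property (FHCSG)
   makes the widths of boundedly many slabs add up to [s]. *)
Lemma lambda_scale_cover (R : realType) (lambda : nat -> R) (q : nat) (c e : R) :
  (forall n, (1 <= n)%N -> 0 < lambda n) ->
  (forall m n, (1 <= m)%N -> (m < n)%N -> lambda m < lambda n) ->
  (forall C : R, 0 < C -> exists p : nat, forall N, (1 <= N)%N ->
     C / lambda N <= \sum_(N.+1 <= n < (N + p).+1) (lambda n)^-1) ->
  (0 < q)%N -> 0 < c -> 0 < e -> forall m : nat,
  exists p : nat, (0 < p)%N /\ forall N, (1 <= N)%N ->
  exists E : nat -> set (nat -> R),
  [/\ forall n x, E n x -> (N < n <= N + p)%N /\ (q %| n)%N,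
      forall n x x', E n x -> E n x' ->
        (forall i, (i < m)%N -> `|x i - x' i| < c / lambda n) ->
        forall i, (i < m)%N -> x i = x' i &
      forall y : nat -> R, exists n x, E n x /\
        forall i, (i < m)%N -> `|y i - x i| <= e / lambda n].
Proof.
move=> l0 lincr lsum q0 c0 e0.
have ldecr m n : (1 <= m)%N -> (m <= n)%N -> (lambda n)^-1 <= (lambda m)^-1.
  move=> m0; rewrite leq_eqVlt => /orP [/eqP -> //|mn].
  have ln : 0 < lambda n by apply: l0; exact: ltn_trans mn.
  by rewrite lef_pV2 ?posrE ?ln ?l0 // ltW ?lincr.
elim=> [|m [p [p0 IH]]].
  (* In dimension 0 no coordinate matters: a multiple of [q] in [(N, N + q]] suffices. *)
  exists q; split=> // N N0; exists (fun n _ => (N < n <= N + q)%N /\ (q %| n)%N).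
  split=> // y; exists ((N %/ q).+1 * q)%N, y; split=> //; split; last exact: dvdn_mull.
  by rewrite mulSn; have := divn_eq N q; have := ltn_pmod N q0; lia.
have pR : 0 < p%:R :> R by rewrite ltr0n.
(* The summand [p] pays for the sampled term at index [N], which belongs to no [w j]; the rest
   amounts to [s] after multiplication by [2 * e / p]. *)
have [|J sumJ] := lsum (p%:R + c * p%:R / (2 * e)).
  by rewrite addr_gt0 // divr_gt0 // mulr_gt0.
have J0 : (0 < J)%N.
  rewrite lt0n; apply/eqP => J0; have := sumJ 1%N isT.
  rewrite J0 addn0 big_geq // leNgt divr_gt0 ?l0 //.
  by rewrite addr_gt0 // divr_gt0 // mulr_gt0.
exists (J * p)%N; split; first by rewrite muln_gt0 J0.
move=> N N0; pose s := c / lambda N; have s0 : 0 < s by rewrite divr_gt0 ?l0.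
(* The scale at the end of window [j] is the smallest there, so [w j <= e / lambda n] throughout the
   window. *)
pose w j := e / lambda (N + j.+1 * p)%N.
have ws : s <= \sum_(j < J) 2 * w j.
  have := sumJ N N0.
  have : \sum_(N.+1 <= n < (N + J).+1) (lambda n)^-1 <=
      \sum_(N.+1 <= n < (N + J.+1 * p).+1) (lambda n)^-1.
    rewrite [leRHS](@big_cat_nat _ _ _ (N + J).+1) //=; first last.
    - by rewrite ltnS leq_add2l; nia.
    - by rewrite ltnS leq_addr.
    rewrite lerDl big_nat_cond sumr_ge0 // => n /andP [/andP [n0 _] _].
    by rewrite invr_ge0 ltW // l0 //; lia.
  have := @sum_decreasing_le_step _ (fun n => (lambda n)^-1) p ldecr N J.+1 N0.
  rewrite big_ord_recl mul0n addn0 /=.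
  have -> : \sum_(j < J) 2 * w j =
      2 * e * \sum_(j < J) (lambda (N + bump 0 j * p)%N)^-1.
    by rewrite mulr_sumr; apply: eq_bigr => j _; rewrite /w mulrA.
  move: (\sum_(j < J) _) => S; rewrite mulrDr mulrDl => h1 h2 h3.
  have : c * p%:R / (2 * e) / lambda N <= p%:R * S by lra.
  have -> : c * p%:R / (2 * e) / lambda N = p%:R * (s / (2 * e)).
    by rewrite /s; field; rewrite !gt_eqF ?l0.
  by rewrite ler_pM2l // ler_pdivrMr ?mulr_gt0 // mulrC.
have /choice [F FP] : forall j, exists E : nat -> set (nat -> R),
  [/\ forall n x, E n x -> (N + j * p < n <= N + j * p + p)%N /\ (q %| n)%N,
      forall n x x', E n x -> E n x' ->
        (forall i, (i < m)%N -> `|x i - x' i| < c / lambda n) ->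
        forall i, (i < m)%N -> x i = x' i &
      forall y : nat -> R, exists n x, E n x /\
        forall i, (i < m)%N -> `|y i - x i| <= e / lambda n].
  by move=> j; apply: IH; rewrite addn_gt0 N0.
pose t j := \sum_(i < j) 2 * w i + w j.
exists (fun n x => exists j v (z : int), [/\ (j < J)%N, F j n v,
  forall i, (i < m)%N -> x i = v i & x m = t j + s * z%:~R]); split.
- move=> n x [j [v [z [jJ Fv _ _]]]].
  have [/(_ _ _ Fv) [jn qn] _ _] := FP j; split=> //.
  have : (j.+1 * p <= J * p)%N by rewrite leq_mul2r jJ orbT.
  by rewrite mulSn; lia.
- move=> n x x' [j [v [z [jJ Fv xv xm]]]] [j' [v' [z' [jJ' Fv' xv' xm']]]] xx'.
  have [/(_ _ _ Fv) [jn _] sepj _] := FP j.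
  have [/(_ _ _ Fv') [jn' _] _ _] := FP j'.
  (* An index lies in one window only. The last coordinates then differ by a multiple of [s], and by
     less than [c / lambda n <= s], so they agree. *)
  have jj' : j = j'.
    apply/eqP; rewrite eqn_leq -ltnS -[X in _ && X]ltnS.
    by apply/andP; split; rewrite -(ltn_pmul2r p0) mulSn; lia.
  subst j'; move=> i; rewrite ltnS leq_eqVlt => /orP [/eqP -> | im].
    rewrite xm xm'; suff -> : z = z' by [].
    have n0 : (1 <= n)%N by lia.
    have : `|x m - x' m| < s.
      apply: lt_le_trans (xx' m (ltnSn m)) _.
      by rewrite ler_pM2l // ldecr //; lia.
    rewrite xm xm' (_ : _ - _ = s * (z - z')%:~R); last by rewrite intrB; ring.
    rewrite normrM (gtr0_norm s0) gtr_pMr // -intr_norm ltrz1.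
    by rewrite -[1]add0r ltzD1 normr_le0 subr_eq0 => /eqP.
  rewrite xv // xv' //; apply: (sepj n) => // k km.
  by rewrite -xv // -xv' //; apply: xx'; exact: ltnW.
- move=> y; have [j [z [jJ yz]]] := line_cover s0 ws (y m).
  have [rangej _ /(_ y) [n [v [Fv yv]]]] := FP j.
  have [jn _] := rangej _ _ Fv.
  exists n, (fun i => if (i < m)%N then v i else t j + s * z%:~R); split.
    exists j, v, z; split=> // [i ->|] //; by rewrite ltnn.
  move=> i; rewrite ltnS leq_eqVlt => /orP [/eqP ->|im]; last by rewrite im yv.
  rewrite ltnn; apply: le_trans yz _.
  by rewrite ler_pM2l // ldecr //; rewrite ?mulSn; lia.
Qed.

(* The indices [n] for which [y a n] comes close to [Z] are bounded linearly in
   [N], and those belonging to disjoint windows of radii are distinct. *)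
Definition coverable (R : realType) (d : nat) (I : Type)
    (y : I -> nat -> 'rV[R]_d) (radius : nat -> R) (S : set I) (B : nat) :=
  forall (c : nat) (e : R), 0 < e -> exists L : nat, forall N, (1 <= N)%N ->
  exists Z : set 'rV[R]_d,
  [/\ forall z, Z z -> radius N <= euclidean_norm z <= radius (N + L)%N,
      forall z z', Z z -> Z z' -> z != z' -> c%:R <= euclidean_norm (z - z') &
      forall a, S a -> exists n z,
        [/\ (0 < n <= B * (N + L))%N, Z z, euclidean_norm (y a n - z) <= e &
            radius N <= euclidean_norm (y a n) <= radius (N + L)%N]].

Lemma gap_ge (R : realType) (lambda : nat -> R) :
  (forall n, (1 <= n)%N -> 1 <= lambda n.+1 - lambda n) ->
  forall m n, (1 <= m)%N -> (m <= n)%N -> (n - m)%N%:R <= lambda n - lambda m.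
Proof.
move=> gap m n m0; elim: n => [|n IH].
  by rewrite leqn0 => /eqP ->; rewrite !subrr.
rewrite leq_eqVlt => /orP [/eqP <-|mn]; first by rewrite subnn subrr.
have := gap n (leq_trans m0 mn); have := IH mn.
rewrite subSn // -natr1; lra.
Qed.

(** Scaling by [lambda n] turns the small balls of the cover into balls of radius at most [e]. The
    indices used are multiples of [c + 2], so points from different [n] have norms at least [c]
    apart; for equal [n] the cover itself is separated. *)
Lemma sphere_coverable (R : realType) (d : nat) (lambda : nat -> R) (B : nat) :
  (0 < B)%N ->
  (forall n, (1 <= n)%N -> 0 < lambda n) -> property_FHCSG lambda ->
  coverable (fun a n => lambda n *: a) lambda
    [set a : 'rV[R]_d | euclidean_norm a = 1] B.
Proof.
move=> B_gt0 l0 [gap lsum] c e0 e0_gt0; pose e := Num.min e0 1.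
have e_gt0 : 0 < e by rewrite lt_min e0_gt0 ltr01.
have e_le1 : e <= 1 by rewrite ge_min lexx orbT.
have lgap := gap_ge gap.
have lincr m n : (1 <= m)%N -> (m < n)%N -> lambda m < lambda n.
  move=> m0 mn; have := lgap m n m0 (ltnW mn).
  have : 1 <= (n - m)%N%:R :> R by rewrite ler1n subn_gt0.
  lra.
have lmono m n : (1 <= m)%N -> (m <= n)%N -> lambda m <= lambda n.
  move=> m0 mn; have := lgap m n m0 mn; have := ler0n R (n - m)%N; lra.
have ed_gt0 : 0 < e / d.+1%:R by rewrite divr_gt0.
have [p [p0 cover]] := lambda_scale_cover l0 lincr lsum
  (isT : 0 < c.+2)%N (ltr0Sn R c) ed_gt0 d.
exists p.+1 => N N0; have [E [Erange Esep Ecov]] := cover N N0.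
pose point n (x : nat -> R) : 'rV[R]_d := lambda n *: \row_i x i.
(* Keeping only points near some [lambda n *: a] with [a] on the sphere puts their norms in the
   annulus; the window [p.+1] leaves room for the error [e <= 1]. *)
pose Z z := exists n x a, [/\ E n x, euclidean_norm a = 1, z = point n x &
  euclidean_norm (lambda n *: a - z) <= e].
have norm_lambda n a : (1 <= n)%N -> euclidean_norm a = 1 ->
    euclidean_norm (lambda n *: a : 'rV[R]_d) = lambda n.
  by move=> n0 a1; rewrite euclidean_normZ a1 mulr1 gtr0_norm ?l0.
have Erange1 n x : E n x -> [/\ (1 <= n)%N, lambda N + 1 <= lambda n,
    lambda n + 1 <= lambda (N + p.+1)%N & (c.+2 %| n)%N].
  move=> /Erange [/andP [Nn nN] qn]; split=> //; first by lia.
    by have := lmono N.+1 n isT Nn; have := gap N N0; lra.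
  have n0 : (1 <= n)%N by lia.
  have := gap n n0; have /lmono : (n.+1 <= N + p.+1)%N by lia.
  by move=> /(_ isT); lra.
have near_lambda n (a z : 'rV[R]_d) : (1 <= n)%N -> euclidean_norm a = 1 ->
    euclidean_norm (lambda n *: a - z) <= e ->
    `|lambda n - euclidean_norm z| <= 1.
  move=> n0 a1 za; rewrite -(norm_lambda n a n0 a1).
  by apply: le_trans (euclidean_norm_dist _ _) _; apply: le_trans za _.
exists Z; split.
- move=> z [n [x [a [Enx a1 _ za]]]]; have [n0 nl nu _] := Erange1 _ _ Enx.
  by have := near_lambda _ _ _ n0 a1 za; rewrite ler_norml; lra.
- have far n n' x x' (a a' z z' : 'rV[R]_d) : E n x -> E n' x' ->
      euclidean_norm a = 1 -> euclidean_norm a' = 1 ->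
      euclidean_norm (lambda n *: a - z) <= e ->
      euclidean_norm (lambda n' *: a' - z') <= e -> (n < n')%N ->
      c%:R <= euclidean_norm (z - z').
    move=> Enx Enx' a1 a1' za za' nn'.
    have [n0 _ _ qn] := Erange1 _ _ Enx.
    have [n0' _ _ qn'] := Erange1 _ _ Enx'.
    have := near_lambda _ _ _ n0 a1 za; have := near_lambda _ _ _ n0' a1' za'.
    have := lgap n n' n0 (ltnW nn').
    have : c.+2%:R <= (n' - n)%N%:R :> R.
      by rewrite ler_nat; apply: dvdn_leq; rewrite ?subn_gt0 // dvdn_sub.
    have := euclidean_norm_dist z z'.
    by rewrite !ler_norml -[c.+2%:R]natr1 -natr1; lra.
  move=> z z' [n [x [a [Enx a1 zx za]]]] [n' [x' [a' [Enx' a1' zx' za']]]] zz'.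
  have [nn'|nn'|nn'] := ltngtP n n'.
  + exact: (far n n' x x' a a').
  + rewrite -opprB euclidean_normN; exact: (far n' n x' x a' a).
  subst n'; rewrite leNgt; apply/negP => zc.
  have [n0 _ _ _] := Erange1 _ _ Enx.
  case/negP: zz'; apply/eqP; rewrite zx zx'; congr (_ *: _).
  apply/rowP => i; rewrite !mxE; apply: (Esep n) => // k kd.
  rewrite ltr_pdivlMr ?l0 //.
  have := euclidean_norm_coord (z - z') (Ordinal kd); rewrite zx zx' !mxE /=.
  rewrite -mulrBr normrM (gtr0_norm (l0 _ n0)) mulrC -zx -zx' => le_zz'.
  by apply: le_lt_trans le_zz' _; apply: lt_trans zc _; rewrite ltr_nat.
- move=> a a1; pose y k : R := odflt 0 (omap (a ord0) (insub k)).
  have [n [x [Enx xy]]] := Ecov y; have [n0 nl nu _] := Erange1 _ _ Enx.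
  have za : euclidean_norm (lambda n *: a - point n x) <= e.
    rewrite -scalerBr euclidean_normZ (gtr0_norm (l0 _ n0)) mulrC.
    rewrite -ler_pdivlMr ?l0 //.
    apply: (@le_trans _ _ (d%:R * (e / d.+1%:R / lambda n))).
      apply: euclidean_norm_le_coord => [k|]; last by rewrite !divr_ge0 ?ltW // l0.
      by have := xy k (ltn_ord k); rewrite /y valK /= !mxE.
    rewrite mulrA ler_pM2r ?invr_gt0 ?l0 // mulrCA ger_pMr //.
    by rewrite ler_pdivrMr // mul1r ler_nat.
  exists n, (point n x); split.
  + rewrite n0; have [/andP [_ nN] _] := Erange _ _ Enx.
    by apply: leq_trans (leq_pmull _ B_gt0); lia.
  + by exists n, x, a.
  + by apply: le_trans za _; rewrite ge_min lexx.
  + by rewrite norm_lambda //; apply/andP; split; lra.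
Qed.

(** * Arithmetic progressions through the origin *)

(** Each choice leaves at most the fraction [1 - 1 / #|V|] of the remaining set unhit, and by
    hypothesis less than one element remains after [p] choices. *)
Lemma greedy_hitting (V T : finType) (v0 : V) (p : nat)
    (hit : nat -> V -> T -> bool) (S : {set T}) :
  (forall i t, (i < p)%N -> exists v, hit i v t) ->
  (#|S| * #|V|.-1 ^ p < #|V| ^ p)%N ->
  exists v : nat -> V, forall t, t \in S -> exists2 i, (i < p)%N & hit i (v i) t.
Proof.
have V0 : (0 < #|V|)%N by apply/card_gt0P; exists v0.
elim: p S => [|p IH] S hitP; first rewrite !expn0 muln1 ltnS leqn0 cards_eq0.
  by move=> /eqP ->; exists (fun=> v0) => t; rewrite inE.
move=> Sp; pose hitset v := [set t in S | hit p v t].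
(* Every [t] is hit by some [v], so some [v] hits a fraction [1 / #|V|] of [S]. *)
have [v /eqP Sv] : exists v, (#|S| <= #|V| * #|hitset v|)%N.
  apply/existsP; apply: contraT; rewrite negb_exists => /forallP few.
  have : (#|S| <= \sum_v #|hitset v|)%N.
    apply: leq_trans (_ : \sum_(t in S) \sum_v hit p v t <= _)%N.
      rewrite -sum1_card; apply: leq_sum => t _.
      by have [v vt] := hitP p t (ltnSn p); rewrite (bigD1 v) //= vt.
    rewrite exchange_big /=; apply: leq_sum => v _.
    rewrite -[leqRHS]sum1_card big_mkcond [leqRHS]big_mkcond /=.
    by apply: leq_sum => t _; rewrite inE; case: (t \in S); case: (hit p v t).
  have : (\sum_v #|V| * #|hitset v| < \sum_(v : V) #|S|)%N.
    rewrite (bigD1 v0) //= [X in (_ < X)%N](bigD1 v0) //= -addSn.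
    apply: leq_add; first by rewrite ltnNge few.
    by apply: leq_sum => v _; apply: ltnW; rewrite ltnNge few.
  by rewrite -big_distrr /= sum_nat_const ltn_pmul2l // ltnNge => /negP.
have card_rest : (#|V| * #|S :\: hitset v| <= #|V|.-1 * #|S|)%N.
  rewrite cardsD (_ : S :&: hitset v = hitset v); last first.
    by apply/finset.setIidPr/fintype.subsetP => t; rewrite inE => /andP [].
  move: V0 Sv; rewrite mulnBr; case: #|V| => //= M _; rewrite mulSn; lia.
have [||v' v'P] := IH (S :\: hitset v).
- by move=> i t ip; apply: hitP; exact: ltnW.
- rewrite -(ltn_pmul2l V0) mulnA -[X in (_ < X)%N]expnS.
  apply: leq_ltn_trans Sp.
  by rewrite [(_ ^ p.+1)%N]expnS mulnA [(#|S| * _)%N]mulnC leq_mul2r card_rest orbT.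
exists (fun i => if i == p then v else v' i) => t tS.
have [tv|tv] := boolP (t \in hitset v).
  by exists p; rewrite ?eqxx //; move: tv; rewrite inE => /andP [].
have [|i ip h] := v'P t; first by rewrite inE tv tS.
by exists i; [exact: ltnW | rewrite ltn_eqF].
Qed.

(** Bernoulli's inequality in the form [(1 + 1/m)^r >= 1 + r/(m+1)], cleared of denominators. *)
Lemma bernoulli_nat (m r : nat) : ((m.+1 + r) * m ^ r <= m.+1 ^ r.+1)%N.
Proof.
elim: r => [|r IH]; first by rewrite muln1 addn0 expn1.
rewrite [leqRHS]expnS; apply: leq_trans (leq_mul (leqnn m.+1) IH).
by rewrite expnS !mulnA leq_mul2r; apply/orP; right; nia.
Qed.

Lemma polynomial_lt_exponential (M a d : nat) : (0 < M)%N ->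
  exists p, ((a * p.+1) ^ d * M.-1 ^ p < M ^ p)%N.
Proof.
case: M => // m _ /=.
(* As [p + 1 <= d.+2 * r], the polynomial factor is at most [(b r)^d]. The power [d.+1] of
   Bernoulli's inequality supplies [r^(d+1)], and [r] is chosen to exceed the remaining constant. *)
pose b := (a * d.+2)%N; pose r := (b ^ d * m.+1 ^ d.+1).+1.
pose p := (r * d.+1)%N; exists p.
have [mp0|mp0] := posnP (m ^ p); first by rewrite mp0 muln0 expn_gt0.
rewrite -(ltn_pmul2l (_ : 0 < m.+1 ^ d.+1)%N) ?expn_gt0 //.
have -> : (m.+1 ^ d.+1 * m.+1 ^ p = (m.+1 ^ r.+1) ^ d.+1)%N.
  by rewrite -expnM -expnD mulSn.
apply: (@leq_trans (((m.+1 + r) * m ^ r) ^ d.+1)); last first.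
  by rewrite leq_exp2r // bernoulli_nat.
rewrite [X in (_ < X)%N]expnMn -expnM -/p mulnA ltn_pmul2r //.
apply: (@leq_ltn_trans (m.+1 ^ d.+1 * (b * r) ^ d)).
  rewrite leq_mul2l; apply/orP; right; case: (d) @b @r @p mp0 => [|d'] b r p mp0 //.
  by rewrite leq_exp2r // /b -mulnA leq_mul2l /p; apply/orP; right; rewrite /r; nia.
apply: (@leq_trans (r ^ d.+1)); last by rewrite leq_exp2r // leq_addl.
by rewrite expnMn mulnA [X in (_ < X)%N]expnS ltn_pmul2r ?expn_gt0 // mulnC.
Qed.

(** This rounding modulo [c] serves both to choose lattice shifts and to encode starting
    positions. *)
Lemma cell_mod (R : realType) (c : R) (M : nat) : 0 < c ->
  exists cell : R -> 'I_M.+1, forall x, exists k : int,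
    `|x - ((cell x)%:R * (c / M.+1%:R) + c * k%:~R)| <= c / M.+1%:R.
Proof.
move=> c0; suff /choice [f fP] : forall x : R, exists v : 'I_M.+1, exists k : int,
    `|x - (v%:R * (c / M.+1%:R) + c * k%:~R)| <= c / M.+1%:R by exists f.
move=> x.
have M0 : 0 < M.+1%:R :> R by rewrite ltr0n.
set k := Num.floor (x / c).
have [r0 r1] : 0 <= (x / c - k%:~R) * M.+1%:R /\ (x / c - k%:~R) * M.+1%:R < M.+1%:R.
  have := floor_itv (x / c); rewrite -/k intrD => /andP [h1 h2].
  by rewrite mulr_ge0 ?subr_ge0 ?ler0n // gtr_pMl //; split=> //; lra.
set r := _ * _ in r0 r1.
have rM : (Num.truncn r < M.+1)%N by rewrite truncn_lt_nat.
exists (Ordinal rM), k => /=.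
have -> : x - ((Num.truncn r)%:R * (c / M.+1%:R) + c * k%:~R) =
    (r - (Num.truncn r)%:R) * (c / M.+1%:R).
  by rewrite /r; field; rewrite !gt_eqF.
have /andP [t1 t2] := truncn_itv r0.
rewrite normrM (gtr0_norm (divr_gt0 c0 M0)) ler_piMl ?divr_ge0 ?(ltW c0) //.
by rewrite ler_norml; move: t2; rewrite -natr1; lra.
Qed.

Lemma cell_interval (R : realType) (B G : nat) :
  exists cell : R -> 'I_(2 * B * G.+1).+1, forall x y, `|x| <= B%:R -> `|y| <= B%:R ->
    cell x = cell y -> `|x - y| <= G.+1%:R^-1.
Proof.
have G0 : 0 < G.+1%:R :> R by rewrite ltr0n.
exists (fun x => inord (Num.truncn ((x + B%:R) * G.+1%:R))) => x y.
have cell (z : R) : `|z| <= B%:R -> let r := (z + B%:R) * G.+1%:R in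
    0 <= r /\ (Num.truncn r < (2 * B * G.+1).+1)%N.
  rewrite ler_norml => /andP [h1 h2] /=.
  have r0 : 0 <= (z + B%:R) * G.+1%:R by rewrite mulr_ge0 ?ler0n //; lra.
  split=> //; rewrite truncn_lt_nat // -[X in _ < X]natr1 !natrM.
  by apply: (@le_lt_trans _ _ (2 * B%:R * G.+1%:R)); [rewrite ler_pM2r|]; lra.
move=> /cell [/truncn_itv x0 xt] /cell [/truncn_itv y0 yt] /(congr1 val).
rewrite /= !inordK // => xy; move: x0 y0; rewrite xy.
set t := Num.truncn _; rewrite -[t.+1%:R]natr1.
set u := (x + _) * _; set v := (y + _) * _ => /andP [x1 x2] /andP [y1 y2].
have -> : x - y = (u - v) * G.+1%:R^-1 by rewrite /u /v; field; rewrite gt_eqF.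
rewrite normrM [X in _ * X]gtr0_norm ?invr_gt0 // ler_piMl ?invr_ge0 ?ler0n //.
by rewrite ler_norml; lra.
Qed.

(* The annulus is cut into [p] shells of width [W]; in shell [i], [Z] consists of
   the points of a translate [v i + c Z^d] of a lattice. The multiples of [a]
   traverse all shells, and up to an error [h] their position modulo [c Z^d] in
   each shell depends only on [code a], which takes polynomially many values in
   [p]. Choosing the [v i] greedily makes the number of codes not yet hit decay
   geometrically, so a large [p] suffices, independently of [N]. *)
Lemma multiples_coverable (R : realType) (d B : nat) : (0 < B)%N ->
  coverable (fun a n => n%:R *: a) (fun n => n%:R : R)
    [set a : 'rV[R]_d | B%:R^-1 <= euclidean_norm a <= B%:R] B.
Proof.
move=> B_gt0 c0 e0 e0_gt0; pose e := Num.min e0 1.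
have e_gt0 : 0 < e by rewrite lt_min e0_gt0 ltr01.
have e_le1 : e <= 1 by rewrite ge_min lexx orbT.
have BR : 0 < B%:R :> R by rewrite ltr0n.
pose c : R := c0.+1%:R; have c_gt0 : 0 < c by rewrite ltr0n.
(* Chosen so that an error of [4 * h] in every coordinate stays below [e] in norm. *)
pose M := Num.truncn (c * 4 * d.+1%:R / e).
pose h := c / M.+1%:R; have h_gt0 : 0 < h by rewrite divr_gt0.
have h_le : d%:R * (4 * h) <= e.
  apply: (@le_trans _ _ (d.+1%:R * (4 * h))).
    by rewrite ler_pM2r ?mulr_gt0 // ler_nat.
  have := truncnS_gt (c * 4 * d.+1%:R / e); rewrite -/M ltr_pdivrMr // => /ltW.
  have -> : d.+1%:R * (4 * h) = c * 4 * d.+1%:R / M.+1%:R by rewrite /h; ring.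
  by rewrite ler_pdivrMr // [e * _]mulrC.
(* A shell of width [2 B + 4], then a gap exceeding [c0]. *)
pose W := (2 * B + 4 + c0.+1)%N.
(* [M.+1 ^ d] is the number of shifts; the power of degree [d] will bound the number of codes. *)
have [p ltp] := @polynomial_lt_exponential (M.+1 ^ d)
  (M.+1 * (2 * B * M.+1 * (W * B + 1) + 1)) d (expn_gt0 _ _).
(* Reaching a shell takes at most [p W B + 1] steps from the start, so coordinates of [a] known up
   to [1 / G] drift by at most [1 / M.+1 <= h]. *)
pose G := (M.+1 * (p * W * B + 1))%N.
have G_gt0 : (0 < G)%N by rewrite muln_gt0 addn1.
have [cell1 cell1P] := @cell_mod R c M c_gt0.
have [cell2 cell2P] := cell_interval R B G.-1.
rewrite prednK // in cell2 cell2P.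
pose V : finType := {ffun 'I_d -> 'I_M.+1}.
pose T : finType := ({ffun 'I_d -> 'I_M.+1} *
                     {ffun 'I_d -> 'I_(2 * B * G).+1})%type.
pose S := [set a : 'rV[R]_d | B%:R^-1 <= euclidean_norm a <= B%:R].
exists (p * W + 2)%N => N N0.
have shell_next i j : (i < j)%N -> (N + i * W + 2 * B + 4 + c0 <= N + j * W)%N.
  move=> ij; have le_W : (i.+1 * W <= j * W)%N by rewrite leq_mul2r ij orbT.
  have W_gt : (2 * B + 4 + c0 < W)%N by rewrite /W ltn_add2l.
  by move: le_W W_gt; rewrite mulSn; clear; lia.
have shell_last i : (i < p)%N -> (N + i * W + 2 * B + 4 <= N + (p * W + 2))%N.
  move=> /shell_next lt_ip; apply: leq_trans (leq_trans (leq_addr c0 _) lt_ip) _.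
  by rewrite leq_add2l leq_addr.
(* The multiples of [a] pass norm [N + 2] at [n0 a], and [m i a] further steps lead to shell [i].
   Only [n0] depends on [N], so [m] is bounded uniformly. *)
pose n0 (a : 'rV[R]_d) := (Num.truncn ((N + 2)%:R / euclidean_norm a)).+1.
pose m i (a : 'rV[R]_d) := (Num.truncn ((i * W)%:R / euclidean_norm a)).+1.
have step a x : S a -> let k := (Num.truncn (x%:R / euclidean_norm a)).+1 in
    x%:R < k%:R * euclidean_norm a <= x%:R + B%:R /\ (k <= x * B + 1)%N.
  move=> /andP [a1 a2] k.
  have a_gt0 : 0 < euclidean_norm a by apply: lt_le_trans a1; rewrite invr_gt0.
  have /truncn_itv /andP [] : 0 <= x%:R / euclidean_norm a.
    by rewrite divr_ge0 ?ler0n // ltW.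
  rewrite ler_pdivlMr // ltr_pdivrMr // -/k => h1 h2.
  split; first by rewrite h2 /k -natr1 mulrDl mul1r lerD.
  rewrite addn1 /k ltnS -(ler_nat R) natrM -ler_pdivrMr //.
  apply: le_trans h1; rewrite ler_pdivrMr // -mulrA ler_peMr ?ler0n //.
  by rewrite -ler_pdivrMr // mul1r.
pose code (a : 'rV[R]_d) : T := ([ffun j => cell1 ((n0 a)%:R * a ord0 j)],
                                 [ffun j => cell2 (a ord0 j)]).
pose close (v : V) (r : R) (z : 'rV[R]_d) := forall j, exists k : int,
  `|z ord0 j - ((v j)%:R * h + c * k%:~R)| <= r.
pose hits i v a := exists2 n : nat, close v (4 * h) (n%:R *: a) &
  (N + 1 + i * W)%:R <= n%:R * euclidean_norm a <= (N + i * W + 2 * B + 3)%:R.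
have [||v vP] := @greedy_hitting V T [ffun=> ord0] p
  (fun i v t => `[< forall a, S a -> code a = t -> hits i v a >]) [set: T]%SET.
- move=> i t ip.
  have [[a [Sa at_]]|none] := pselect (exists a, S a /\ code a = t); last first.
    by exists [ffun=> ord0]; apply/asboolP => a Sa at_; case: none; exists a.
  (* The shift is read off one representative [a]; every [b] with the same code hits after the same
     number [m i a] of steps beyond its own [n0 b]. *)
  exists [ffun j => cell1 ((n0 a + m i a)%N%:R * a ord0 j)].
  apply/asboolP => b Sb bt.
  have [ma m_le] := step a (i * W)%N Sa.
  rewrite -/(m i a) in ma m_le.
  have m_le' : (m i a)%:R <= G%:R / M.+1%:R :> R.
    rewrite ler_pdivlMr // -natrM ler_nat mulnC /G leq_mul2l /=.
    apply: leq_trans m_le _; rewrite leq_add2r leq_mul2r leq_mul2r ltnW ?orbT //.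
  have ab_coord j : `|b ord0 j - a ord0 j| <= G%:R^-1.
    have coord x : S x -> `|x ord0 j| <= B%:R.
      by move=> /andP [_]; apply: le_trans (euclidean_norm_coord _ _).
    apply: cell2P; [exact: coord|exact: coord|].
    have : (code b).2 j = (code a).2 j by rewrite bt at_.
    by rewrite !ffunE.
  have mab j : (m i a)%:R * `|b ord0 j - a ord0 j| <= h.
    apply: (@le_trans _ _ (G%:R / M.+1%:R * G%:R^-1)).
      by apply: ler_pM; rewrite ?ler0n.
    have -> : G%:R / M.+1%:R * G%:R^-1 = 1 / M.+1%:R :> R.
      by rewrite mulrAC divff // pnatr_eq0 -lt0n.
    by rewrite ler_pM2r ?invr_gt0 // /c ler1n.
  exists (n0 b + m i a)%N.
    move=> j; rewrite ffunE mxE.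
    have [k3] := cell1P ((n0 a + m i a)%:R * a ord0 j).
    have [k2] := cell1P ((n0 a)%:R * a ord0 j).
    have [k1] := cell1P ((n0 b)%:R * b ord0 j).
    have <- : cell1 ((n0 a)%:R * a ord0 j) = cell1 ((n0 b)%:R * b ord0 j).
      have : (code a).1 j = (code b).1 j by rewrite bt at_.
      by rewrite !ffunE.
    rewrite -/h; move: (cell1 _) (cell1 _) => x v h1 h2 h3.
    (* Three roundings and one drift, each at most [h], add up to [4 * h]. *)
    exists (k3 + k1 - k2).
    have := mab j; rewrite -{1}(ger0_norm (ler0n R (m i a))) -normrM.
    move: h1 h2 h3; rewrite !natrD intrB intrD !ler_norml; lra.
  (* The first [n0 b] steps reach a norm between [N + 2] and [N + 2 + B]; the others add between
     [i W] and [i W + B], up to a drift of 1. *)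
  have /andP [b1 b2] := (step b (N + 2)%N Sb).1.
  rewrite -/(n0 b) in b1 b2; case/andP: ma => m1 m2.
  have nab : `|(m i a)%:R * euclidean_norm b - (m i a)%:R * euclidean_norm a| <= 1.
    rewrite -mulrBr normrM ger0_norm ?ler0n //.
    apply: (@le_trans _ _ ((m i a)%:R * euclidean_norm (b - a))).
      by rewrite ler_wpM2l ?ler0n // euclidean_norm_dist.
    rewrite -[X in X * _]ger0_norm ?ler0n // -euclidean_normZ.
    apply: (@le_trans _ _ (d%:R * h)).
      apply: euclidean_norm_le_coord => [j|]; last exact: ltW.
      by rewrite !mxE normrM ger0_norm ?ler0n.
    have := ler0n R d; have : 0 <= d%:R * h by rewrite mulr_ge0 ?ler0n ?ltW.
    by move: h_le e_le1; lra.
  move: nab b1 b2 m1 m2; rewrite ler_norml !natrD mulrDl !natrM; lra.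
- rewrite cardsT card_prod !card_ffun !card_ord.
  apply: leq_ltn_trans ltp; rewrite -expnMn leq_mul2r; apply/orP; right.
  have [->|d_gt0] := posnP d; first by rewrite !expn0.
  rewrite leq_exp2r // -[leqRHS]mulnA leq_mul2l /= /G; move: (M.+1) (W) => x w; nia.
pose Z z := exists i, [/\ (i < p)%N, close (v i) 0 z &
  (N + i * W)%:R <= euclidean_norm z <= (N + i * W + 2 * B + 4)%:R].
exists Z; split.
- move=> z [i [ip _ /andP [z1 z2]]]; apply/andP; split.
    by apply: le_trans z1; rewrite ler_nat leq_addr.
  by apply: le_trans z2 _; rewrite ler_nat shell_last.
- have far i i' (z z' : 'rV[R]_d) :
      euclidean_norm z <= (N + i * W + 2 * B + 4)%:R ->
      (N + i' * W)%:R <= euclidean_norm z' -> (i < i')%N ->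
      c0%:R <= euclidean_norm (z - z').
    move=> z1 z2 ii'; have := euclidean_norm_dist z z'.
    have : (N + i * W + 2 * B + 4 + c0)%:R <= (N + i' * W)%:R :> R.
      by rewrite ler_nat shell_next.
    by rewrite natrD ler_norml; lra.
  move=> z z' [i [ip zi /andP [z1 z2]]] [i' [ip' zi' /andP [z1' z2']]] zz'.
  have [ii'|ii'|ii'] := ltngtP i i'.
  + exact: (far i i').
  + rewrite -opprB euclidean_normN; exact: (far i' i).
  subst i'; have [j zj] : exists j, z ord0 j != z' ord0 j.
    apply/existsP; apply: contraT; rewrite negb_exists => /forallP eqz.
    case/negP: zz'; apply/eqP/rowP => j; apply/eqP; have := eqz j.
    by rewrite negbK.
  apply: le_trans (euclidean_norm_coord _ j); rewrite !mxE.
  have [k] := zi j; have [k'] := zi' j; rewrite !normr_le0 !subr_eq0.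
  move=> /eqP zk' /eqP zk; move: zj; rewrite zk zk' => kk'.
  rewrite opprD addrACA subrr add0r -mulrBr -intrB normrM (gtr0_norm c_gt0).
  have : 1 <= `|(k - k')%:~R| :> R.
    rewrite -intr_norm ler1z -gtz0_ge1 normr_gt0 subr_eq0.
    by apply: contra_neq kk' => ->.
  have : c0%:R <= c by rewrite ler_nat.
  by move=> h1 h2; apply: le_trans h1 _; rewrite ler_peMr // ltW.
- move=> a Sa; have [i ip /asboolP /(_ a Sa erefl)] := vP (code a) (finset.in_setT _).
  move=> [n nv /andP [n1 n2]]; have /choice [k kP] := nv.
  pose z : 'rV[R]_d := \row_j ((v i j)%:R * h + c * (k j)%:~R).
  have za : euclidean_norm (n%:R *: a - z) <= e.
    apply: le_trans h_le; apply: euclidean_norm_le_coord => [j|]; last first.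
      by rewrite mulr_ge0 // ltW.
    by have := kP j; rewrite !mxE.
  have na : euclidean_norm (n%:R *: a) = n%:R * euclidean_norm a.
    by rewrite euclidean_normZ ger0_norm ?ler0n.
  have n3 : n%:R * euclidean_norm a <= (N + (p * W + 2))%:R.
    apply: le_trans n2 _; rewrite ler_nat; apply: leq_trans (shell_last i ip).
    by rewrite leq_add2l.
  exists n, z; split.
  + apply/andP; split.
      rewrite lt0n; apply/eqP => n0_; move: n1; rewrite n0_ mul0r leNgt ltr0n.
      by rewrite addn1 addSn.
    rewrite -(ler_nat R) natrM mulrC -ler_pdivrMr //.
    apply: le_trans n3; rewrite ler_wpM2l ?ler0n //.
    by case/andP: Sa.
  + exists i; split=> //.
      by move=> j; exists (k j); rewrite mxE subrr normr0.
    have := euclidean_norm_dist (n%:R *: a) z; rewrite na => dist.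
    have : `|n%:R * euclidean_norm a - euclidean_norm z| <= 1.
      by apply: le_trans dist _; apply: le_trans e_le1.
    rewrite ler_norml; move: n1 n2; rewrite !natrD; lra.
  + by apply: le_trans za _; rewrite ge_min lexx.
  + rewrite na n3 andbT; apply: le_trans n1.
    by rewrite ler_nat -addnA leq_addr.
Qed.

(** * Common frequently hypercyclic vectors *)

Lemma strongly_continuous_at0 (R : realType) (K : numFieldType) (d : nat)
    (X : tvsType K) (T : 'rV[R]_d -> {linear X -> X}) (q : nat -> X -> K) :
  operator_group T -> strongly_continuous T -> defines_topology q ->
  forall p (g : X) (e : K), (0 < p)%N -> 0 < e ->
  exists r : R, 0 < r <= 1 /\
    forall b, euclidean_norm b <= r -> q p (T b g - g) < e.
Proof.
move=> [_ T0 _] Tcont qtop p g e p0 e0.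
have /(_ _ (seminorm_ball_nbhs (T 0 g) qtop p0 e0)) := Tcont g 0.
(* Halving [r] gives strict inequalities; the cap 1 will allow the growth bound with [s = 1]. *)
move=> /nbhs_ballP [r /= r0 rP]; exists (Num.min (r / 2) 1); split.
  by rewrite lt_min divr_gt0 //= ltr01 ge_min lexx orbT.
move=> b br; have := rP b; rewrite /= T0; apply.
split=> // i j; rewrite -ball_normE /= ord1 mxE sub0r normrN.
apply: le_lt_trans (euclidean_norm_coord b j) _.
by apply: le_lt_trans br _; rewrite gt_min ltr_pdivrMr // ltr_pMr // ltr1n.
Qed.

Lemma separable_dense_seq (X : topologicalType) (x0 : X) : separable_space X ->
  exists g : nat -> X, forall U : set X, open U -> U !=set0 -> exists i, U (g i).
Proof.
move=> [D [/countable_injP [f finj] Ddense]].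
exists (fun i => xget x0 [set x | D x /\ f x = i]) => U Uopen U0.
have [x [Ux Dx]] := Ddense U U0 Uopen; exists (f x).
case: xgetP => [x' _ [Dx' ff]|/(_ x) []]; last by split.
by rewrite (finj x' x) // inE.
Qed.

(* A type encodes a target [g i], a seminorm, a precision [m.+1^-1] and an index
   [B] of parameters. If [T z f] is close to the target in the seminorm of index
   [1 + C p], then [T b f] is close to it in the seminorm of index [p] for all
   [b] near [z]. *)
Lemma common_FHC (R : realType) (k : scalar_kind) (d : nat)
    (X : tvsType (scalar_field R k)) (T : 'rV[R]_d -> {linear X -> X})
    (I : Type) (y : I -> nat -> 'rV[R]_d) (radius : nat -> R) (S : nat -> set I) :
  frechet_space X -> separable_space X -> operator_group T ->
  strongly_continuous T -> uniformly_runge_transitive T ->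
  (forall n, (1 <= n)%N -> 0 < radius n) ->
  (forall n, (1 <= n)%N -> 1 <= radius n.+1 - radius n) ->
  (forall B, coverable y radius (S B) B.+1) ->
  exists x : X, forall B a, S B a -> FHC R (fun n => T (y a n)) x.
Proof.
move=> [_ _ complete] sepX grT scT.
move=> [q [A [C [[[qsemi qincr] qtop] [A0 C0] bound runge]]]].
move=> rad0 gap cover; have rgap := gap_ge gap.
have rmono m n : (1 <= m)%N -> (m <= n)%N -> radius m <= radius n.
  by move=> m0 mn; have := rgap m n m0 mn; have := ler0n R (n - m)%N; lra.
have [g gdense] := separable_dense_seq 0 sepX.
pose decode t : nat * nat * nat * nat := odflt (0, 0, 0, 0)%N (unpickle t).
pose hh t := g (decode t).1.1.1.
pose pp t := (decode t).1.1.2.+1.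
pose mm t := (decode t).1.2.
pose BB t := (decode t).2.
(* The growth bound with [s = 1] leads from [q p] to [q (1 + C p)] with factor [A p 1]; [M] makes
   the resulting error half the precision. *)
pose P t := (1 + C (pp t))%N.
pose M t := (4 * (mm t).+1 * A (pp t) 1)%N.
have [|dl dlP] := @choice nat R (fun t r => 0 < r <= 1 /\ forall b,
    euclidean_norm b <= r -> q (pp t) (T b (hh t) - hh t) < (2 * (mm t).+1%:R)^-1).
  by move=> t; apply: (strongly_continuous_at0 grT scT qtop).
have [|L LP] := @choice nat nat (fun t L => forall N, (1 <= N)%N ->
  exists Z : set 'rV[R]_d,
  [/\ forall z, Z z -> radius N <= euclidean_norm z <= radius (N + L)%N,
      forall z z', Z z -> Z z' -> z != z' ->
        (C (P t))%:R <= euclidean_norm (z - z') &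
      forall a, S (BB t) a -> exists n z,
        [/\ (0 < n <= (BB t).+1 * (N + L))%N, Z z, euclidean_norm (y a n - z) <= dl t &
            radius N <= euclidean_norm (y a n) <= radius (N + L)%N]]).
  by move=> t; apply: cover; have [/andP []] := dlP t.
(* Margin on both sides of a window of radii, for the separation constants and for rounding radii to
   the integers [s] and [u]. *)
pose D t := (C (P t) + 2)%N.
have [pos [typ [K [posS posK typP]]]] := schedule (fun t => 2 * D t + L t + 1)%N.
pose N j := (pos j + D (typ j) + 1)%N.
have N0 j : (1 <= N j)%N by rewrite /N addn1.
have [|Z ZP] := @choice nat (set 'rV[R]_d) (fun j Z =>
  [/\ forall z, Z z -> radius (N j) <= euclidean_norm z <= radius (N j + L (typ j))%N,
      forall z z', Z z -> Z z' -> z != z' ->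
        (C (P (typ j)))%:R <= euclidean_norm (z - z') &
      forall a, S (BB (typ j)) a -> exists n z,
        [/\ (0 < n <= (BB (typ j)).+1 * (N j + L (typ j)))%N, Z z,
            euclidean_norm (y a n - z) <= dl (typ j) &
            radius (N j) <= euclidean_norm (y a n) <= radius (N j + L (typ j))%N]]).
  by move=> j; apply: LP.
have posmono i j : (i < j)%N -> (pos i.+1 <= pos j)%N.
  elim: j => // j IH; rewrite ltnS leq_eqVlt => /orP [/eqP -> //|/IH].
  by have := posS j; lia.
have windows i j : (i < j)%N ->
    radius (N i + L (typ i))%N + (C (P (typ i)) + C (P (typ j)) + 2)%:R <= radius (N j).
  move=> ij; have NN : (N i + L (typ i) + (C (P (typ i)) + C (P (typ j)) + 2) <= N j)%N.
    by have := posS i; have := posmono i j ij; rewrite /N /D; lia.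
  have N1 : (1 <= N i + L (typ i))%N by rewrite addn_gt0 N0.
  have := rgap _ _ N1 (leq_trans (leq_addr _ _) NN).
  have : (C (P (typ i)) + C (P (typ j)) + 2)%:R <=
      (N j - (N i + L (typ i)))%N%:R :> R by rewrite ler_nat; lia.
  by lra.
pose s j := Num.truncn (radius (N j)).
pose u j := (Num.truncn (radius (N j + L (typ j))%N)).+1.
have rad_ge0 j n : 0 <= radius (N j + n)%N.
  by apply/ltW/rad0; rewrite addn_gt0 N0.
have rad_ge0' j : 0 <= radius (N j) by apply/ltW/rad0.
have [|||||||||f fP] := @simultaneous_approximation R _ d X T q A C (P \o typ)
  (hh \o typ) (M \o typ) s u Z (@scalar_field_archimedean R k) complete _
  (conj qsemi qincr) qtop A0 C0 bound runge.
- by have [] := grT.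
- by move=> j.
- by move=> j; rewrite /= !muln_gt0 A0.
- move=> j; rewrite /= /s truncn_gt_nat.
  have := rgap 1%N (N j) isT (N0 j); have := rad0 1%N isT.
  have : (C (P (typ j))).+1%:R <= (N j - 1)%N%:R :> R.
    by rewrite ler_nat /N /D; lia.
  by lra.
- move=> j; apply: leqW; apply: le_truncn; apply: rmono; rewrite ?N0 //.
  exact: leq_addr.
- move=> i j ij /=; rewrite /s truncn_ge_nat //.
  apply: le_trans (windows i j ij); rewrite /u !natrD.
  have /andP [h _] := truncn_itv (rad_ge0 i (L (typ i))).
  by move: h; rewrite -natr1; lra.
- move=> j; have [Zr Zs _] := ZP j.
  apply: (@separated_bounded_finite _ _ _ (C (P (typ j)))%:R
            (radius (N j + L (typ j))%N)) => //.
    by rewrite ltr0n C0.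
  by move=> z /Zr /andP [].
- move=> j z; have [Zr _ _] := ZP j => /Zr /andP [z1 z2].
  have /andP [h1 _] := truncn_itv (rad_ge0' j).
  have /andP [_ h2] := truncn_itv (rad_ge0 j (L (typ j))).
  by rewrite (le_trans h1 z1) (le_trans z2 (ltW h2)).
- by move=> j; have [] := ZP j.
exists f => B a SBa U Uopen [x0 Ux0].
have /qtop [p [e [p0 e0 pU]]] : nbhs x0 U by apply: open_nbhs_nbhs; split.
have e20 : 0 < e / 2 by rewrite divr_gt0.
have [m me] := scalar_field_archimedean e20.
have [_ _ qD] := qsemi p p0.
have := @open_interior _ [set x | q p (x - x0) < m.+1%:R^-1].
move=> /gdense [|i /interior_subset /= gi].
  by exists x0; apply: seminorm_ball_nbhs => //; rewrite invr_gt0.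
have near_gi x : q p (x - g i) < m.+1%:R^-1 -> U x.
  move=> xi; apply: pU => /=; have -> : x - x0 = (x - g i) + (g i - x0).
    by rewrite addrA subrK.
  apply: le_lt_trans (qD _ _) _; rewrite [e]splitr.
  by apply: ltrD; [exact: lt_trans me|exact: lt_trans me].
pose t := pickle (i, p.-1, m, B).
have decode_t : decode t = (i, p.-1, m, B) by rewrite /decode pickleK.
have hht : hh t = g i by rewrite /hh decode_t.
have ppt : pp t = p by rewrite /pp decode_t prednK.
have mmt : mm t = m by rewrite /mm decode_t.
have BBt : BB t = B by rewrite /BB decode_t.
have [c [c' [c_gt0 ctyp]]] := typP t.
pose jj l := (c * l + c')%N.
(* Each stage of type [t] yields one index. Disjoint windows of radii make these distinct, and
   [posK] bounds them linearly in [l]. *)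
have [|n nP] := @choice nat nat (fun l n => exists z,
   [/\ (0 < n <= B.+1 * (N (jj l) + L t))%N, Z (jj l) z,
       euclidean_norm (y a n - z) <= dl t &
       radius (N (jj l)) <= euclidean_norm (y a n) <= radius (N (jj l) + L t)%N]).
  move=> l; have [_ _ /(_ a)] := ZP (jj l).
  by rewrite /jj ctyp BBt; apply.
apply: (@lower_density_gt0 _ _ n (B.+1 * K * (c + c' + 1)).+1) => //.
- have lt_n l l' : (l < l')%N -> n l <> n l'.
    move=> ll' nn; have [_ [_ _ _ /andP [_ n1]]] := nP l.
    have [_ [_ _ _ /andP [n2 _]]] := nP l'.
    have jj' : (jj l < jj l')%N by rewrite ltn_add2r ltn_pmul2l.
    have := windows _ _ jj'; rewrite {1 2}/jj ctyp -/(jj l).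
    by move: n1 n2; rewrite nn !natrD; have := ler0n R (C (P t));
       have := ler0n R (C (P (typ (jj l')))); lra.
  move=> l l' nn; have [ll'|ll'|//] := ltngtP l l'.
    by case: (lt_n _ _ ll').
  by case: (lt_n _ _ ll').
- move=> l; have [z [/andP [-> nB] _ _ _]] := nP l; apply: leq_trans nB _ => /=.
  have NL : (N (jj l) + L t <= pos (jj l).+1)%N.
    by have := posS (jj l); rewrite /N {2 3}/jj ctyp /D; lia.
  apply: leq_trans (_ : B.+1 * (K * (jj l).+1) <= _)%N.
    by rewrite leq_mul2l (leq_trans NL (posK _)) orbT.
  rewrite [leqRHS]mulSn; apply: leq_trans (leq_addl _ _).
  by rewrite -!mulnA !leq_mul2l /jj; apply/orP; right; apply/orP; right; nia.
- move=> l; have [z [_ Zz yz _]] := nP l; apply: near_gi => /=.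
  have := fP _ _ Zz; rewrite /= /jj ctyp hht /M ppt mmt /P ppt => fz.
  have [/andP [_ dl1] dlb] := dlP t.
  have -> : T (y a (n l)) f - g i =
      T (y a (n l) - z) (T z f - g i) + (T (y a (n l) - z) (g i) - g i).
    have [_ _ TD] := grT.
    by rewrite linearB /= -TD subrK addrA subrK.
  apply: le_lt_trans (qD _ _) _.
  have -> : m.+1%:R^-1 = (2 * m.+1%:R)^-1 + (2 * m.+1%:R)^-1 :> scalar_field R k.
    by rewrite invfM -mulrDl -[2^-1]mul1r -splitr mul1r.
  apply: ler_ltD; last by have := dlb _ yz; rewrite ppt hht mmt.
  apply: le_trans (bound p 1%N _ _ p0 isT (le_trans yz dl1)) _.
  have alg (F : numFieldType) (v w : F) : v != 0 -> w != 0 ->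
      2 / (4 * v * w) = w^-1 * (2 * v)^-1.
    by move=> v0 w0; field; rewrite v0 w0.
  have Ap0 : 0 < (A p 1)%:R :> scalar_field R k by rewrite ltr0n A0.
  rewrite -ler_pdivlMl //; apply: le_trans fz _.
  by rewrite !natrM alg ?(gt_eqF Ap0) ?pnatr_eq0.
Qed.

Theorem theorem5p13 (R : realType) (k : scalar_kind) (d : nat)
  (X : tvsType (scalar_field R k)) (lambda : nat -> R)
  (T : 'rV[R]_d -> {linear X -> X}) :
  (1 <= d)%N ->
  frechet_space X ->
  separable_space X ->
  (forall n, (1 <= n)%N -> 0 < lambda n) ->
  (forall m n, (1 <= m)%N -> (m < n)%N -> lambda m < lambda n) ->
  property_FHCSG lambda ->
  operator_group T ->
  strongly_continuous T ->
  uniformly_runge_transitive T ->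
  (\bigcap_(a in [set a : 'rV[R]_d | euclidean_norm a = 1])
     FHC R (fun n => T (lambda n *: a))) !=set0 /\
  (\bigcap_(a in [set a : 'rV[R]_d | a != 0])
     FHC R (fun n => iter n (T a))) !=set0.
Proof.
move=> _ frX sepX l0 _ fhcsg grT scT rungeT; split.
  have [x xP] := common_FHC (S := fun=> [set a : 'rV[R]_d | euclidean_norm a = 1])
    frX sepX grT scT rungeT l0 fhcsg.1
    (fun B => @sphere_coverable R d lambda B.+1 (ltn0Sn B) l0 fhcsg).
  by exists x => a; exact: (xP 0%N a).
(* These countably many annuli exhaust the nonzero vectors, and [T_a^n = T_{n a}]. *)
have [||x xP] := common_FHC (radius := fun n => n%:R)
    (S := fun B => [set a : 'rV[R]_d | B.+1%:R^-1 <= euclidean_norm a <= B.+1%:R])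
    frX sepX grT scT rungeT _ _
    (fun B => @multiples_coverable R d B.+1 (ltn0Sn B)).
- by move=> n n0; rewrite ltr0n.
- by move=> n _; rewrite -natr1 addrAC subrr add0r.
exists x => a /= a_neq0.
have a_gt0 : 0 < euclidean_norm a.
  by rewrite lt_neqAle euclidean_norm_ge0 eq_sym euclidean_norm_eq0 a_neq0.
have -> : (fun n => iter n (T a)) = (fun n => T (n%:R *: a) : X -> X).
  apply/funext => n; apply/funext => f; have [_ T0 TD] := grT.
  elim: n => [|n IH]; first by rewrite scale0r T0.
  by rewrite iterS IH -TD -nat1r scalerDl scale1r.
apply: (xP (maxn (Num.truncn (euclidean_norm a)) (Num.truncn (euclidean_norm a)^-1))).
have le_max (r : R) m : (Num.truncn r <= m)%N -> r <= m.+1%:R.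
  by move=> rm; apply: le_trans (ltW (truncnS_gt r)) _; rewrite ler_nat.
by rewrite /= invf_ple ?posrE // !le_max // ?leq_maxl ?leq_maxr.
Qed.
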